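(* Let $\mathcal R=(\mathbb R,<,+,\dots)$ be an expansion of the ordered additive group of real numbers which is type B. Then every continuous definable function $f:I\to\mathbb R$, where $I$ is a nonempty bounded open interval, is repetitious.
   Context: ''Definable'' means definable in $\mathcal R$ with parameters. A set is $\omega$-orderable if it is definable and either finite or admits a definable ordering of order type $\omega$; it is dense if it is dense in some nonempty open interval. $\mathcal R$ is type B if it defines a dense $\omega$-orderable set but there is some compact subset of some $\mathbb R^k$ that it does not define. A function $f:I\to\mathbb R$ is repetitious if for every open subinterval $J\subseteq I$ there are $\delta>0$ and $x,y\in J$ with $\delta<y-x$ and $f(x+\epsilon)-f(x)=f(y+\epsilon)-f(y)$ for all $0\le\epsilon<\delta$. *)

(* Defs.v *)
From mathcomp Require Import all_boot all_order all_algebra.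
From mathcomp Require Import all_classical all_reals all_analysis.

Set Implicit Arguments.
Unset Strict Implicit.
Unset Printing Implicit Defensive.

Import Order.TTheory GRing.Theory Num.Theory.
Import numFieldNormedType.Exports.

Local Open Scope classical_set_scope.
Local Open Scope ring_scope.

(* An expansion of (R, <, +) is given by its additional function and relation
   symbols (of arbitrary finite arity, arity 0 included) together with their
   interpretations on R; the symbols < and + are built into the syntax below. *)
Record expansion (R : realType) : Type := Expansion {
  fun_sym : Type;
  fun_arity : fun_sym -> nat;
  fun_interp : forall s : fun_sym, ('I_(fun_arity s) -> R) -> R;
  rel_sym : Type;
  rel_arity : rel_sym -> nat;
  rel_interp : forall s : rel_sym, ('I_(rel_arity s) -> R) -> Prop
}.

Section Definability.
Context {R : realType} (M : expansion R).

Inductive term : Type :=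
| TVar of nat
| TAdd of term & term
| TApp (s : fun_sym M) of ('I_(fun_arity s) -> term).

(* De Bruijn indices: [FEx] binds variable 0 and shifts the others by one. *)
Inductive formula : Type :=
| FEq of term & term
| FLt of term & term
| FRel (s : rel_sym M) of ('I_(rel_arity s) -> term)
| FNot of formula
| FAnd of formula & formula
| FEx of formula.

Fixpoint eval (e : nat -> R) (t : term) : R :=
  match t with
  | TVar i => e i
  | TAdd t1 t2 => eval e t1 + eval e t2
  | TApp s ts => fun_interp (fun i => eval e (ts i))
  end.

Definition scons (x : R) (e : nat -> R) : nat -> R :=
  fun i => if i is j.+1 then e j else x.

Fixpoint sat (e : nat -> R) (phi : formula) : Prop :=
  match phi with
  | FEq t1 t2 => eval e t1 = eval e t2
  | FLt t1 t2 => eval e t1 < eval e t2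
  | FRel s ts => rel_interp (fun i => eval e (ts i))
  | FNot phi1 => ~ sat e phi1
  | FAnd phi1 phi2 => sat e phi1 /\ sat e phi2
  | FEx phi1 => exists x : R, sat (scons x e) phi1
  end.

(* Variables 0, ..., k - 1 are the coordinates of v, and variable k + j is the
   parameter p j (a formula only mentions finitely many of them). *)
Definition with_params (k : nat) (v : 'rV[R]_k) (p : nat -> R) : nat -> R :=
  fun i => if insub i is Some j then v 0 j else p (i - k)%N.

Definition definable (k : nat) (D : set 'rV[R]_k) : Prop :=
  exists (phi : formula) (p : nat -> R),
    forall v : 'rV[R]_k, D v <-> sat (with_params v p) phi.

Definition line (D : set R) : set 'rV[R]_1 := [set v | D (v 0 0)].

(* f : R -> R represents a function with domain I; its values outside I are
   irrelevant. *)
Definition definable_fun (I : set R) (f : R -> R) : Prop :=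
  definable [set v : 'rV[R]_2 | I (v 0 0) /\ v 0 1 = f (v 0 0)].

(* The binary relation given by E, restricted to D, is isomorphic to
   (nat, <); in particular it is a strict linear order on D. *)
Definition order_type_omega (k : nat) (D : set 'rV[R]_k)
    (E : set 'rV[R]_(k + k)) : Prop :=
  exists e : nat -> 'rV[R]_k, set_bij [set: nat] D e /\
    forall m n : nat, E (row_mx (e m) (e n)) <-> (m < n)%N.

Definition omega_orderable (k : nat) (D : set 'rV[R]_k) : Prop :=
  definable D /\
  (finite_set D \/
   exists E : set 'rV[R]_(k + k), definable E /\ order_type_omega D E).

End Definability.

Definition open_interval {R : realType} (J : set R) : Prop :=
  [/\ is_interval J, open J & J !=set0].

Definition somewhere_dense {R : realType} (D : set R) : Prop :=
  exists J : set R, open_interval J /\ J `<=` closure (D `&` J).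

Definition type_B {R : realType} (M : expansion R) : Prop :=
  (exists D : set R, omega_orderable M (line D) /\ somewhere_dense D) /\
  (exists (k : nat) (K : set 'rV[R]_k), compact K /\ ~ definable M K).

(* As f is only meaningful on I, the identity is required together with its
   terms being defined, i.e. with x + eps and y + eps lying in I. *)
Definition repetitious {R : realType} (I : set R) (f : R -> R) : Prop :=
  forall J : set R, open_interval J -> J `<=` I ->
    exists delta x y : R,
      [/\ 0 < delta, J x, J y, delta < y - x &
       forall eps : R, 0 <= eps < delta ->
         [/\ I (x + eps), I (y + eps) &
          f (x + eps) - f x = f (y + eps) - f y]].

(* Main.v *)
Require Import Defs.
From mathcomp Require Import all_boot all_order all_algebra.
From mathcomp Require Import all_classical all_reals all_analysis.
From mathcomp Require Import lra zify.

Set Implicit Arguments.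
Unset Strict Implicit.
Unset Printing Implicit Defensive.

Import Order.TTheory GRing.Theory Num.Theory.
Import numFieldNormedType.Exports.

Local Open Scope classical_set_scope.
Local Open Scope ring_scope.

(* Suppose f is not repetitious: after shrinking J, distinct points x, x' of J
   have distinct right germs w |-> f (x + w) - f x.  Let d enumerate the dense
   omega-orderable set D.  A real t singles out definably the set of stages n
   for which d n is a best approximation of t from the right; by moving t close
   to the last stage, the next one can be postponed as far as desired.  At
   stage n, any other real y can be read off relative to its component in the
   complement of d 0, ..., d n, and a nested interval construction lets
   finitely many reals have prescribed small readings, up to an open error, at
   all stages of t simultaneously.
   Reading off a small increment w and bounds l < h, one tests whether
   l < f (x + w) - f x < h; since germs differ, finitely many tests isolate any
   given point of D among its predecessors.  Hence every sequence of tuples of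
   points of D is definable from finitely many reals, so is every union of open
   boxes with corners in (a rescaling of) D, and so is every compact set. *)

(** * Renaming of variables in formulas *)

Section Renaming.
Context {R : realType} (M : expansion R).

Fixpoint term_rename (s : nat -> nat) (t : term M) : term M :=
  match t with
  | TVar i => TVar M (s i)
  | TAdd t1 t2 => TAdd (term_rename s t1) (term_rename s t2)
  | TApp g ts => TApp (fun i => term_rename s (ts i))
  end.

Definition rename_lift (s : nat -> nat) (i : nat) : nat :=
  if i is j.+1 then (s j).+1 else 0.

Fixpoint formula_rename (s : nat -> nat) (phi : formula M) : formula M :=
  match phi with
  | FEq t1 t2 => FEq (term_rename s t1) (term_rename s t2)
  | FLt t1 t2 => FLt (term_rename s t1) (term_rename s t2)
  | FRel r ts => FRel (fun i => term_rename s (ts i))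
  | FNot phi1 => FNot (formula_rename s phi1)
  | FAnd phi1 phi2 => FAnd (formula_rename s phi1) (formula_rename s phi2)
  | FEx phi1 => FEx (formula_rename (rename_lift s) phi1)
  end.

Lemma eval_rename (s : nat -> nat) (e : nat -> R) (t : term M) :
  Defs.eval e (term_rename s t) = Defs.eval (e \o s) t.
Proof.
elim: t => [i|t1 IH1 t2 IH2|g ts IH] //=; first by rewrite IH1 IH2.
by congr fun_interp; apply/funext => i; exact: IH.
Qed.

Lemma sat_rename (phi : formula M) (s : nat -> nat) (e : nat -> R) :
  sat e (formula_rename s phi) <-> sat (e \o s) phi.
Proof.
elim: phi s e => [t1 t2|t1 t2|r ts|p1 IH|p1 IH1 p2 IH2|p1 IH] s e /=.
- by rewrite !eval_rename.
- by rewrite !eval_rename.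
- by rewrite (_ : (fun i => _) = (fun i => Defs.eval (e \o s) (ts i))) //;
    apply/funext => i; exact: eval_rename.
- by rewrite IH.
- by rewrite IH1 IH2.
- have E x : scons x e \o rename_lift s = scons x (e \o s).
    by apply/funext => -[].
  by split=> -[x]; move: (IH (rename_lift s) (scons x e)); rewrite E => IHx /IHx;
    exists x.
Qed.

End Renaming.

(** * A calculus of definable predicates on environments *)

Definition interleave {R : Type} (e p : nat -> R) (i : nat) : R :=
  if odd i then p i./2 else e i./2.

Section Calculus.
Context {R : realType} (M : expansion R).

(* Even variables are the free variables, odd variables the parameters. *)
Definition Def (P : (nat -> R) -> Prop) : Prop :=
  exists (phi : formula M) (p : nat -> R),
    forall e, P e <-> sat (interleave e p) phi.

Lemma Def_ext (P Q : (nat -> R) -> Prop) :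
  (forall e, P e <-> Q e) -> Def P -> Def Q.
Proof. by move=> PQ [phi [p H]]; exists phi, p => e; rewrite -PQ. Qed.

Lemma Def_rename (P : (nat -> R) -> Prop) (s : nat -> nat) :
  Def P -> Def (fun e => P (e \o s)).
Proof.
move=> [phi [p H]].
pose s' i := if odd i then i else (s i./2).*2.
exists (formula_rename s' phi), p => e.
rewrite H sat_rename.
rewrite (_ : interleave (e \o s) p = interleave e p \o s') //.
apply/funext => i; rewrite /interleave /s' /=.
by case: ifP => [->//|oi]; rewrite odd_double doubleK.
Qed.

Lemma Def_not (P : (nat -> R) -> Prop) : Def P -> Def (fun e => ~ P e).
Proof. by move=> [phi [p H]]; exists (FNot phi), p => e /=; rewrite H. Qed.

Lemma Def_and (P Q : (nat -> R) -> Prop) :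
  Def P -> Def Q -> Def (fun e => P e /\ Q e).
Proof.
move=> [phi [p Hp]] [psi [q Hq]].
(* Both parameter sequences fit into one by interleaving them in turn; [sp] and [sq] redirect odd
   variables to their own half and fix the even ones. *)
pose sp i := if odd i then (i./2).*2.*2.+1 else i.
pose sq i := if odd i then ((i./2).*2.+1).*2.+1 else i.
exists (FAnd (formula_rename sp phi) (formula_rename sq psi)), (interleave p q).
move=> e /=; rewrite Hp Hq !sat_rename.
have -> : interleave e p = interleave e (interleave p q) \o sp.
  apply/funext => i; rewrite /interleave /= /sp.
  by case: ifP => [oi|->//]; rewrite /= odd_double /= uphalf_double odd_double doubleK.
have -> : interleave e q = interleave e (interleave p q) \o sq.
  apply/funext => i; rewrite /interleave /= /sq.
  by case: ifP => [oi|->//];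
    rewrite /= odd_double /= uphalf_double /= odd_double /= uphalf_double.
by [].
Qed.

Lemma Def_exists (P : R -> (nat -> R) -> Prop) :
  Def (fun e => P (e 0%N) (fun i => e i.+1)) -> Def (fun e => exists x, P x e).
Proof.
move=> [phi [p H]].
(* The binder occupies position 0 and pushes all others up by one. So free variable [i], expected at
   2i+2, is found at 2i+1, each parameter is found one place later, and [0.-1 = 0] hits the bound
   variable. *)
pose s i := if odd i then i.+1 else i.-1.
exists (FEx (formula_rename s phi)), p => e /=.
have E x : interleave (scons x e) p = scons x (interleave e p) \o s.
  apply/funext => i; rewrite /interleave /s /=.
  case: ifP => [oi|oi] /=; first by rewrite oi.
  case: i oi => [|[|i]] //= /negbT; rewrite !negbK => oi.
  by rewrite (negbTE oi).
split=> -[x Px]; exists x.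
- by rewrite sat_rename -E -H.
- by move: Px; rewrite sat_rename -E -H.
Qed.

Lemma Def_or (P Q : (nat -> R) -> Prop) :
  Def P -> Def Q -> Def (fun e => P e \/ Q e).
Proof.
move=> DP DQ; apply: (@Def_ext (fun e => ~ (~ P e /\ ~ Q e))).
  by move=> e; rewrite not_andP !notK.
by apply: Def_not; apply: Def_and; exact: Def_not.
Qed.

Lemma Def_imply (P Q : (nat -> R) -> Prop) :
  Def P -> Def Q -> Def (fun e => P e -> Q e).
Proof.
move=> DP DQ; apply: (@Def_ext (fun e => ~ (P e /\ ~ Q e))).
  by move=> e; rewrite not_andP notK implyE.
by apply: Def_not; apply: Def_and => //; exact: Def_not.
Qed.

Lemma Def_forall (P : R -> (nat -> R) -> Prop) :
  Def (fun e => P (e 0%N) (fun i => e i.+1)) -> Def (fun e => forall x, P x e).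
Proof.
move=> DP; apply: (@Def_ext (fun e => ~ exists x, ~ P x e)).
  by move=> e; rewrite -forallNP; split=> H x; [apply: contrapT|move/(_ (H x))].
by apply: Def_not; apply: (@Def_exists (fun x e => ~ P x e)); exact: Def_not.
Qed.

Lemma Def_const (P : Prop) : Def (fun=> P).
Proof.
have T : Def (fun=> True) by exists (FEq (TVar M 0) (TVar M 0)), (fun=> 0).
have [p|np] := pselect P; first by apply: Def_ext T.
by apply: Def_ext (Def_not T) => e; split.
Qed.

Lemma Def_forall_fin (I : finType) (P : I -> (nat -> R) -> Prop) :
  (forall i, Def (P i)) -> Def (fun e => forall i, P i e).
Proof.
move=> DP; suff H (s : seq I) : Def (fun e => forall i, i \in s -> P i e).
  apply: Def_ext (H (enum I)) => e.
  by split=> + i => /(_ i); rewrite mem_enum; auto.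
elim: s => [|j s IH]; first by apply: Def_ext (Def_const True).
apply: Def_ext (Def_and (DP j) IH) => e; split.
  by move=> [Pj Ps] i; rewrite inE => /orP[/eqP->//|]; exact: Ps.
by move=> H; split=> [|i si]; apply: H; rewrite inE ?eqxx ?si ?orbT.
Qed.

(** Working with graphs instead of syntactic terms lets definable functions that are not symbols of
    the language be composed like terms. *)
Definition DefT (x : (nat -> R) -> R) : Prop :=
  Def (fun e => e 0%N = x (fun i => e i.+1)).

Lemma DefT_weaken (x : (nat -> R) -> R) :
  DefT x -> DefT (fun e => x (fun i => e i.+1)).
Proof.
move=> Dx; pose s i := if i is j.+1 then j.+2 else 0%N.
exact: (Def_rename s Dx).
Qed.

(** Name the two values by existential quantifiers, [b] outside and [a] inside, so that [a] and [b]
    become variables 0 and 1 as [P] expects. *)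
Lemma Def_subst2 (P : R -> R -> Prop) (x y : (nat -> R) -> R) :
  Def (fun e => P (e 0%N) (e 1%N)) -> DefT x -> DefT y ->
  Def (fun e => P (x e) (y e)).
Proof.
move=> DP Dx Dy.
apply: (@Def_ext (fun e => exists b, b = y e /\ exists a, a = x e /\ P a b)).
  move=> e; split=> [[b [-> [a [->]]]]//|Pxy].
  by exists (y e); split=> //; exists (x e).
apply: Def_exists; apply: Def_and => //.
apply: (@Def_exists (fun a e => a = x (fun i => e i.+1) /\ P a (e 0%N))).
apply: Def_and => //; exact: DefT_weaken.
Qed.

Lemma DefT_graph2 (g : R -> R -> R) (x y : (nat -> R) -> R) :
  Def (fun e => e 0%N = g (e 1%N) (e 2%N)) -> DefT x -> DefT y ->
  DefT (fun e => g (x e) (y e)).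
Proof.
move=> Dg Dx Dy.
apply: (@Def_ext (fun e => exists b, b = y (fun i => e i.+1) /\
    exists a, a = x (fun i => e i.+1) /\ e 0%N = g a b)).
  move=> e; split=> [[b [-> [a [->]]]]//|Pxy].
  by exists (y (fun i => e i.+1)); split=> //; exists (x (fun i => e i.+1)).
apply: (@Def_exists (fun b e => b = y (fun i => e i.+1) /\
    exists a, a = x (fun i => e i.+1) /\ e 0%N = g a b)).
apply: Def_and; first exact: DefT_weaken.
apply: (@Def_exists (fun a e => a = x (fun i => e i.+2) /\ e 1%N = g a (e 0%N))).
apply: Def_and; first exact: (DefT_weaken (DefT_weaken Dx)).
pose s i := if i is j.+1 then j else 2%N.
exact: (Def_rename s Dg).
Qed.

Lemma DefT_graph1 (g : R -> R) (x : (nat -> R) -> R) :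
  Def (fun e => e 0%N = g (e 1%N)) -> DefT x -> DefT (fun e => g (x e)).
Proof.
by move=> Dg Dx; exact: (@DefT_graph2 (fun a _ => g a) x x).
Qed.

Lemma DefT_var (i : nat) : DefT (fun e => e i).
Proof.
exists (FEq (TVar M 0) (TVar M (i.+1.*2))), (fun=> 0) => e.
by rewrite /= /interleave /= odd_double doubleK.
Qed.

Lemma DefT_const (c : R) : DefT (fun=> c).
Proof. by exists (FEq (TVar M 0) (TVar M 1)), (fun=> c). Qed.

Lemma DefT_add (x y : (nat -> R) -> R) :
  DefT x -> DefT y -> DefT (fun e => x e + y e).
Proof.
apply: (DefT_graph2 (g := +%R)).
by exists (FEq (TVar M 0) (TAdd (TVar M 2) (TVar M 4))), (fun=> 0).
Qed.

Lemma Def_eq (x y : (nat -> R) -> R) :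
  DefT x -> DefT y -> Def (fun e => x e = y e).
Proof.
apply: (Def_subst2 (P := @eq R)).
by exists (FEq (TVar M 0) (TVar M 2)), (fun=> 0).
Qed.

Lemma Def_lt (x y : (nat -> R) -> R) :
  DefT x -> DefT y -> Def (fun e => x e < y e).
Proof.
apply: (Def_subst2 (P := fun a b => a < b)).
by exists (FLt (TVar M 0) (TVar M 2)), (fun=> 0).
Qed.

Lemma DefT_opp (x : (nat -> R) -> R) : DefT x -> DefT (fun e => - x e).
Proof.
apply: DefT_graph1; apply: (@Def_ext (fun e => e 0%N + e 1%N = 0)).
  by move=> e; split=> [/eqP|->]; [rewrite addr_eq0 => /eqP|rewrite addNr].
by apply: Def_eq; [apply: DefT_add; exact: DefT_var|exact: DefT_const].
Qed.

Lemma DefT_mulrn (x : (nat -> R) -> R) (n : nat) :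
  DefT x -> DefT (fun e => x e *+ n).
Proof.
move=> Dx; elim: n => [|n IH]; first exact: DefT_const.
apply: (@Def_ext (fun e => e 0%N = x (fun i => e i.+1) + x (fun i => e i.+1) *+ n)).
  by move=> e; rewrite mulrS.
exact: (DefT_add Dx IH).
Qed.

(** This passes from parameters placed after [k] coordinates to interleaved ones. The latter form
    has no arity, so quantifiers and substitutions need no bookkeeping of [k]. *)
Lemma Def_of_definable (k : nat) (A : set 'rV[R]_k) :
  definable M A -> Def (fun e => A (\row_(j < k) e j)).
Proof.
move=> [phi [p H]].
pose s i := if (i < k)%N then i.*2 else (i - k).*2.+1.
exists (formula_rename s phi), p => e; rewrite H sat_rename.
rewrite (_ : with_params _ _ = interleave e p \o s) //.
apply/funext => i; rewrite /with_params /s /interleave /=.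
case: insubP => [j ij <-|]; first by rewrite mxE ltn_ord odd_double doubleK.
by move=> /negbTE ->; rewrite /= odd_double uphalf_double.
Qed.

Lemma definable_of_Def (k : nat) (A : set 'rV[R]_k) :
  Def (fun e => A (\row_(j < k) e j)) -> definable M A.
Proof.
move=> [phi [p H]].
pose s i := if odd i then (k + i./2)%N else i./2.
exists (formula_rename s phi), p => v; rewrite sat_rename.
have -> : with_params v p \o s = interleave (with_params v p) p.
  apply/funext => i; rewrite /s /interleave /=; case: ifP => // _.
  by rewrite /with_params insubF ?addKn// ltnNge leq_addr.
rewrite -H (_ : \row_j _ = v) //; apply/rowP => j.
by rewrite mxE /with_params valK.
Qed.

End Calculus.

(** * Elementary facts about reals *)

Lemma finite_pos_lower_bound (R : realType) (I : finType) (w : I -> R) :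
  (forall i, 0 < w i) -> exists eta : R, 0 < eta /\ forall i, eta <= w i.
Proof.
move=> w0; suff H (s : seq I) :
    exists eta : R, 0 < eta /\ forall i, i \in s -> eta <= w i.
  by have [eta [e0 He]] := H (enum I); exists eta; split=> // i;
    rewrite He // mem_enum.
elim: s => [|j s [eta [e0 He]]]; first by exists 1.
exists (Order.min eta (w j)); split; first by rewrite lt_min e0 w0.
by move=> i; rewrite inE ge_min => /orP[/eqP->|/He->//]; rewrite lexx orbT.
Qed.

(** The supremum of the left ends works; strict monotonicity on both sides keeps it off all
    endpoints. *)
Lemma nested_intervals (R : realType) (A B : nat -> R) :
  (forall i, A i < A i.+1) -> (forall i, B i.+1 < B i) ->
  (forall i, A i < B i) -> exists y : R, forall i, A i < y < B i.
Proof.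
move=> Ainc Bdec AB.
have Amon i j : A i <= A (i + j)%N.
  elim: j => [|j IH]; first by rewrite addn0.
  by rewrite addnS; exact: le_trans IH (ltW (Ainc _)).
have Bmon i j : B (i + j)%N <= B i.
  elim: j => [|j IH]; first by rewrite addn0.
  by rewrite addnS; exact: le_trans (ltW (Bdec _)) IH.
have ub i : ubound (range A) (B i).
  move=> _ [j _ <-]; apply: le_trans (Amon j i) _.
  by rewrite addnC; apply: le_trans (ltW (AB _)) (Bmon i j).
have hs : has_sup (range A).
  by split; [exists (A 0%N), 0%N|exists (B 0%N); exact: ub].
exists (sup (range A)) => i; apply/andP; split.
- by apply: lt_le_trans (Ainc i) _; apply: sup_upper_bound => //; exists i.+1.
- by apply: le_lt_trans (Bdec i); apply: sup_le_ub (ub _); exists (A 0%N), 0%N.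
Qed.

(** * Best approximations and readings *)

Section Approximation.
Context {R : realType} (d : nat -> R).

Definition right_approx (t : R) (n : nat) : Prop :=
  t < d n /\ forall m, (m < n)%N -> ~ (t < d m /\ d m < d n).

(* The reading z of y at stage n is twice the offset of y from the midpoint
   of its component in the complement of d 0, ..., d n. *)
Definition reading (n : nat) (y z : R) : Prop :=
  exists i, (i <= n)%N /\ exists j, (j <= n)%N /\
    (d i < y /\ y < d j /\
     (forall m, (m <= n)%N -> ~ (d i < d m /\ d m < d j)) /\
     z = y + y - d i - d j).

(** Two components containing [y] have the same ends: an end of one differing from that of the other
    would lie inside the larger component. *)
Lemma reading_uniq (n : nat) (y z z' : R) :
  reading n y z -> reading n y z' -> z = z'.
Proof.
move=> [i [li [j [lj [iy [yj [H ->]]]]]]] [k [lk [l [ll [ky [yl [H' ->]]]]]]].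
have ik : d i = d k.
  apply: le_anti; rewrite !leNgt; apply/andP; split; apply/negP => ?.
    by apply: (H' _ li); split=> //; exact: lt_trans yl.
  by apply: (H _ lk); split=> //; exact: lt_trans yj.
have jl : d j = d l.
  apply: le_anti; rewrite !leNgt; apply/andP; split; apply/negP => ?.
    by apply: (H _ ll); split=> //; exact: lt_trans yl.
  by apply: (H' _ lj); split=> //; exact: lt_trans yj.
by rewrite ik jl.
Qed.

Lemma exists_left_gap (N : nat) (p x : R) : p < x ->
  exists p', [/\ p < p', p' < x &
    forall m, (m <= N)%N -> ~ (p' < d m /\ d m < x)].
Proof.
move=> px; suff [p' [pp' p'x H]] : exists p', [/\ p <= p', p' < x &
    forall m, (m < N.+1)%N -> ~ (p' < d m /\ d m < x)].
  exists ((p' + x) / 2); split; [lra|lra|move=> m mN [p'm mx]].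
  by apply: (H m) => //; split=> //; lra.
elim: N.+1 => [|n [p' [pp' p'x H]]]; first by exists p.
have [dx|xd] := ltP (d n) x; last first.
  exists p'; split=> // m; rewrite ltnS leq_eqVlt => /orP[/eqP->|/H//] [_ dx].
  by move: dx; rewrite ltNge xd.
exists (Order.max p' (d n)); split; first by rewrite le_max pp'.
  by rewrite gt_max p'x dx.
move=> m; rewrite ltnS leq_eqVlt gt_max => /orP[/eqP->|mn] [/andP[p'm dm] mx].
  by rewrite ltxx in dm.
exact: (H m).
Qed.

Lemma exists_left_neighbour (N i : nat) (x : R) : (i <= N)%N -> d i < x ->
  exists k, [/\ (k <= N)%N, d i <= d k, d k < x &
    forall m, (m <= N)%N -> ~ (d k < d m /\ d m < x)].
Proof.
move=> iN ix; suff [k [kN ik kx H]] : exists k, [/\ (k <= N)%N, d i <= d k,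
    d k < x & forall m, (m < N.+1)%N -> ~ (d k < d m /\ d m < x)].
  by exists k.
have: (N.+1 <= N.+1)%N by [].
elim: {1 3}N.+1 => [|n IH] nN; first by exists i.
have [|k [kN ik kx H]] := IH; first exact: ltnW.
have [/andP[dk dx]|nd] := boolP (d k < d n < x).
  exists n; split=> //; first by rewrite (le_trans ik) // ltW.
  move=> m; rewrite ltnS leq_eqVlt => /orP[/eqP->|mn] [nm mx].
    by rewrite ltxx in nm.
  by apply: (H m) => //; split=> //; exact: lt_trans nm.
exists k; split=> // m; rewrite ltnS leq_eqVlt => /orP[/eqP->|/H//] [km mx].
by move: nd; rewrite km mx.
Qed.

End Approximation.

(** At a late stage the available components may be very short, so only small readings can be
    prescribed. A condition can therefore be met if it contains open boxes centred arbitrarily close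
    to 0. *)
Definition boxes_near0 {R : realType} {I : finType} (Q : set (I -> R)) : Prop :=
  forall eta : R, 0 < eta -> exists (z0 : I -> R) (r : R),
    [/\ 0 < r, forall i, `|z0 i| < eta &
     forall z, (forall i, `|z i - z0 i| < r) -> Q z].

(** * Prescribing readings by nested intervals *)

Section Coding.
Context {R : realType} (d : nat -> R) (al be : R) (I : finType).
Context (albe : al < be) (d_inj : injective d).
Context (d_dense : forall x y, al <= x -> x < y -> y <= be ->
  exists n, x < d n /\ d n < y).

(** A finite approximation of the construction: [t] is confined between [stage_lo] and
    [d stage_idx], and the [i]-th coded real between [box_lo i] and [box_hi i]. *)
Record stage : Type := Stage {
  stage_idx : nat; stage_lo : R; box_lo : I -> R; box_hi : I -> R }.

Definition stage_inv (s : stage) : Prop :=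
  [/\ al <= stage_lo s, stage_lo s < d (stage_idx s), d (stage_idx s) <= be,
    (forall m, (m <= stage_idx s)%N ->
       ~ (stage_lo s < d m /\ d m < d (stage_idx s))) &
    forall i, [/\ al <= box_lo s i, box_lo s i < box_hi s i &
                  box_hi s i <= be]].

Definition stage_step (Q : set (I -> R)) (s s' : stage) : Prop :=
  [/\ [/\ (stage_idx s < stage_idx s')%N, stage_lo s < stage_lo s' &
          d (stage_idx s') < d (stage_idx s)],
    (forall i, box_lo s i < box_lo s' i /\ box_hi s' i < box_hi s i),
    (forall t, stage_lo s' < t -> t < d (stage_idx s') ->
       right_approx d t (stage_idx s') /\
       forall m, (stage_idx s < m)%N -> (m < stage_idx s')%N ->
         ~ right_approx d t m) &
    forall y, (forall i, box_lo s' i < y i /\ y i < box_hi s' i) ->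
      exists z, Q z /\ forall i, reading d (stage_idx s') (y i) (z i)].

Lemma stage_extend (Q : set (I -> R)) (s : stage) : boxes_near0 Q ->
  stage_inv s -> exists s', stage_inv s' /\ stage_step Q s s'.
Proof.
case: s => n p A B HQ [/= alp pn nbe pgap AB].
(* Two points of the sequence are fixed in each box: the right one will end the component used, the
   left one keeps that component inside the box. *)
have /choice[ij Hij] : forall i, exists ij : nat * nat,
    [/\ A i < d ij.1, d ij.1 < d ij.2 & d ij.2 < B i].
  move=> i; have [a1 a2 a3] := AB i.
  have [k1 [h1 h2]] := d_dense a1 a2 a3.
  have [k2 [h3 h4]] := d_dense (le_trans a1 (ltW h1)) h2 a3.
  by exists (k1, k2).
pose N := maxn n (\max_i maxn (ij i).1 (ij i).2).
have nN : (n <= N)%N by exact: leq_maxl.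
have ijN i : ((ij i).1 <= N)%N /\ ((ij i).2 <= N)%N.
  have : (maxn (ij i).1 (ij i).2 <= N)%N.
    by apply: leq_trans (leq_maxr _ _); exact: (leq_bigmax i).
  by rewrite geq_max => /andP[].
(* Raising the lower end past all [d m] below [d n] with [m <= N] forces the next best approximation
   to have index beyond [N]. *)
have [p1 [pp1 p1n p1gap]] := exists_left_gap d N pn.
have ex : exists m, p1 < d m < d n.
  have [|m [h1 h2]] := d_dense _ p1n nbe; first by rewrite (le_trans alp) // ltW.
  by exists m; rewrite h1 h2.
case: (ex_minnP ex) => n' /andP[p1n' n'n] n'min.
have Nn' : (N < n')%N.
  by rewrite ltnNge; apply/negP => /p1gap; exact.
have [p' [p1p' p'n' p'gap]] := exists_left_gap d n' p1n'.
(* At stage [n'] the component used in box [i] lies between [d (k i)] and [d (ij i).2]. The minimal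
   length [eta] of these components is known before a box of [Q] is chosen. *)
have /choice[k Hk] : forall i, exists k, [/\ (k <= n')%N, d (ij i).1 <= d k,
    d k < d (ij i).2 & forall m, (m <= n')%N -> ~ (d k < d m /\ d m < d (ij i).2)].
  move=> i; have [_ h _] := Hij i; apply: exists_left_neighbour h.
  by apply: leq_trans (ltnW Nn'); case: (ijN i).
have [eta [eta0 Heta]] : exists eta : R, 0 < eta /\
    forall i, eta <= d (ij i).2 - d (k i).
  apply: finite_pos_lower_bound => i; rewrite subr_gt0.
  by case: (Hk i).
have [z0 [r [r0 Hz0 Hz]]] := HQ _ eta0.
(* [y0 i] is the point with reading [z0 i]; it lies in its component because [z0 i] is smaller than
   the length. Readings move twice as fast as points, so radius [r / 4] is safe. *)
pose y0 i := (z0 i + d (k i) + d (ij i).2) / 2.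
pose A' i := Order.max (d (k i)) (y0 i - r / 4).
pose B' i := Order.min (d (ij i).2) (y0 i + r / 4).
have y0k i : d (k i) < y0 i /\ y0 i < d (ij i).2.
  have := Hz0 i; have := Heta i; rewrite ltr_norml /y0 => h1 /andP[h2 h3].
  by split; lra.
exists (Stage n' p' A' B'); split; split=> //=.
- lra.
- lra.
- move=> i; have [h1 h2 h3] := AB i; have [h4 h5 h6] := Hij i.
  have [h7 h8 h9 _] := Hk i; have [h10 h11] := y0k i; split.
  + by rewrite le_max; apply/orP; left; lra.
  + by rewrite /A' /B' gt_max !lt_min; apply/andP; split; apply/andP; split; lra.
  + by rewrite ge_min; apply/orP; left; lra.
- split=> //; [exact: leq_ltn_trans Nn'|lra].
- move=> i; have [h4 h5 h6] := Hij i.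
  have [h7 h8 h9 _] := Hk i; split.
  + by rewrite lt_max; apply/orP; left; lra.
  + by rewrite gt_min; apply/orP; left.
- move=> t p't tn'.
  have small m : t < d m -> d m < d n -> (n' <= m)%N.
    by move=> tm mn; apply: n'min; apply/andP; split=> //; lra.
  split; first split=> // m mn' [tm mn'2].
    by have := small m tm (lt_trans mn'2 n'n); rewrite leqNgt mn'.
  move=> m nm mn' [tm Hm].
  (* An index [m] strictly between [n] and [n'] is no best approximation: if [d m] is below [d n],
     minimality of [n'] fails; if above, [d n] is a better and earlier one. *)
  have [mn|nm2|/d_inj E] := ltgtP (d m) (d n).
  + by have := small m tm mn; rewrite leqNgt mn'.
  + by apply: (Hm n) => //; split=> //; exact: lt_trans n'n.
  + by rewrite E ltnn in nm.
- move=> y Hy; exists (fun i => y i + y i - d (k i) - d (ij i).2); split.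
    apply: Hz => i; have := Hy i.
    rewrite /A' /B' gt_max lt_min => -[/andP[h1 h2] /andP[h3 h4]].
    by rewrite ltr_norml /y0 in h2 h4 *; apply/andP; split; lra.
  move=> i; have := Hy i; rewrite /A' /B' gt_max lt_min => -[/andP[h1 h2] /andP[h3 h4]].
  have [h5 h6 h7 h8] := Hk i.
  exists (k i); split=> //; exists (ij i).2; split; last by [].
  by apply: leq_trans (ltnW Nn'); case: (ijN i).
Qed.

(** Iterate [stage_extend] and intersect the nested intervals. Best approximations before [n 0] are
    not controlled, hence the restriction on [m]. *)
Lemma coding (Q : nat -> set (I -> R)) : (forall i, boxes_near0 (Q i)) ->
  exists (t : R) (y : I -> R) (n : nat -> nat),
  [/\ forall i, (n i < n i.+1)%N,
      forall m, (n 0 <= m)%N -> right_approx d t m <-> exists i, m = n i &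
      forall i, exists z, Q i z /\ forall j, reading d (n i) (y j) (z j)].
Proof.
move=> HQ.
have [s0 Hs0] : exists s, stage_inv s.
  have [m [alm mbe]] := d_dense (lexx al) albe (lexx be).
  have [p [alp pm Hp]] := exists_left_gap d m alm.
  by exists (Stage m p (fun=> al) (fun=> be)); split=> //=; lra.
have /choice[F HF] : forall js : nat * stage, exists s', stage_inv js.2 ->
    stage_inv s' /\ stage_step (Q js.1) js.2 s'.
  move=> [i s]; have [Hs|] := pselect (stage_inv s); last by exists s.
  by have [s' Hs'] := stage_extend (HQ i) Hs; exists s'.
pose S := fix S i := if i is j.+1 then F (j, S j) else s0.
have Sinv i : stage_inv (S i).
  by elim: i => //= i IH; case: (HF (i, S i) IH).
have Sstep i : stage_step (Q i) (S i) (S i.+1).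
  by case: (HF (i, S i) (Sinv i)).
have [t Ht] : exists t, forall i, stage_lo (S i) < t < d (stage_idx (S i)).
  apply: nested_intervals => i; try by case: (Sstep i) => -[].
  by case: (Sinv i).
have /choice[y Hy] : forall j, exists y, forall i, box_lo (S i) j < y < box_hi (S i) j.
  move=> j; apply: nested_intervals => i;
    try by case: (Sstep i) => _ /(_ j)[].
  by case: (Sinv i) => _ _ _ _ /(_ j)[].
(* The initial stage [S 0] meets no requirement; [Q i] is met on passing from [S i] to [S i.+1]. *)
exists t, y, (fun i => stage_idx (S i.+1)).
have mono i : (stage_idx (S i) < stage_idx (S i.+1))%N.
  by case: (Sstep i) => -[].
split=> [i|m Hm|i]; first exact: mono.
- split; last first.
    move=> [i ->]; case: (Sstep i) => _ _ H _.
    by have /andP[h1 h2] := Ht i.+1; case: (H t).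
  move=> Rm; apply: contrapT => Hn.
  (* A best approximation missed by the sequence would have to lie beyond every stage, since none
     occurs between consecutive ones. *)
  have : forall i, (stage_idx (S i.+1) <= m)%N.
    elim=> // i IH; rewrite leqNgt; apply/negP => mi.
    have [Em|] := eqVneq m (stage_idx (S i.+1)); first by apply: Hn; exists i.
    move=> nm; case: (Sstep i.+1) => _ _ H _.
    have /andP[h1 h2] := Ht i.+2; case: (H t) => // _ /(_ m); apply=> //.
    by rewrite ltn_neqAle eq_sym nm IH.
  have big i : (i <= stage_idx (S i))%N.
    by elim: i => // i IH; exact: leq_ltn_trans (mono i).
  move=> /(_ m) H; have := leq_trans (big m.+1) H.
  by rewrite ltnn.
- case: (Sstep i) => _ _ _; apply => j.
  by have /andP[] := Hy j i.+1.
Qed.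

End Coding.

(** * Definable quantification over indices *)

Section Indices.
Context {R : realType} (M : expansion R) (d : nat -> R).
Context (d_inj : injective d).
Context (Def_prec : Def M (fun e =>
  exists m n, [/\ (m < n)%N, e 0%N = d m & e 1%N = d n])).

(** The number [k] is represented by the real [d k]. The default 0 makes [idx] total, so a
    quantifier over numbers becomes one over all reals. *)
Definition idx (x : R) : nat := xget 0%N [set k | x = d k].

Lemma idxK (k : nat) : idx (d k) = k.
Proof.
rewrite /idx; case: xgetP => [j _ /= /d_inj //|/(_ k) /=].
by move=> /(_ erefl).
Qed.

Definition DefN (a : (nat -> R) -> nat) : Prop := DefT M (fun e => d (a e)).

(** Order type omega has no last element, so the points of the sequence are those that precede
    another one. *)
Lemma Def_range : Def M (fun e => exists k, e 0%N = d k).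
Proof.
apply: (@Def_ext _ _ (fun e => exists y, exists m n,
    [/\ (m < n)%N, e 0%N = d m & y = d n])).
  move=> e; split=> [[y [m [n [_ -> _]]]]|[k ->]]; first by exists m.
  by exists (d k.+1), k, k.+1.
apply: (@Def_exists _ _ (fun y e => exists m n,
    [/\ (m < n)%N, e 0%N = d m & y = d n])).
pose s (i : nat) := (1 - i)%N.
exact: (Def_rename s Def_prec).
Qed.

Lemma DefN_idx (i : nat) : DefN (fun e => idx (e i)).
Proof.
apply: (DefT_graph1 (g := d \o idx)); last exact: DefT_var.
apply: (@Def_ext _ _ (fun e => ((exists k, e 1%N = d k) /\ e 0%N = e 1%N) \/
    ((~ exists k, e 1%N = d k) /\ e 0%N = d 0%N))).
  move=> e /=; have [[k ->]|nk] := pselect (exists k, e 1%N = d k).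
    rewrite idxK; split=> [[[_]//|[]]|->]; last by left; split=> //; exists k.
    by case; exists k.
  rewrite (_ : idx (e 1%N) = 0%N); first by split=> [[[]//|[]//]|]; right.
  by rewrite /idx; case: xgetP => [j _ /= ej|//]; case: nk; exists j.
have D1 : Def M (fun e => exists k, e 1%N = d k).
  exact: (Def_rename S Def_range).
apply: Def_or; apply: Def_and.
- exact: D1.
- by apply: Def_eq; exact: DefT_var.
- exact: Def_not.
- by apply: Def_eq; [exact: DefT_var|exact: DefT_const].
Qed.

Lemma DefN_const (n : nat) : DefN (fun=> n).
Proof. exact: DefT_const. Qed.

Lemma DefT_d (a : (nat -> R) -> nat) : DefN a -> DefT M (fun e => d (a e)).
Proof. by []. Qed.

Lemma Def_existsN (P : nat -> (nat -> R) -> Prop) :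
  Def M (fun e => P (idx (e 0%N)) (fun i => e i.+1)) ->
  Def M (fun e => exists k, P k e).
Proof.
move=> DP; apply: (@Def_ext _ _ (fun e => exists x, P (idx x) e)).
  move=> e; split=> [[x Px]|[k Pk]]; first by exists (idx x).
  by exists (d k); rewrite idxK.
exact: (Def_exists (P := fun x e => P (idx x) e)).
Qed.

Lemma Def_forallN (P : nat -> (nat -> R) -> Prop) :
  Def M (fun e => P (idx (e 0%N)) (fun i => e i.+1)) ->
  Def M (fun e => forall k, P k e).
Proof.
move=> DP; apply: (@Def_ext _ _ (fun e => forall x, P (idx x) e)).
  move=> e; split=> [H k|H x //]; by have := H (d k); rewrite idxK.
exact: (Def_forall (P := fun x e => P (idx x) e)).
Qed.

Lemma Def_substN (P : nat -> nat -> Prop) (a b : (nat -> R) -> nat) :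
  Def M (fun e => P (idx (e 0%N)) (idx (e 1%N))) -> DefN a -> DefN b ->
  Def M (fun e => P (a e) (b e)).
Proof.
move=> DP Da Db.
apply: Def_ext (Def_subst2 (P := fun x y => P (idx x) (idx y)) DP Da Db) => e /=.
by rewrite !idxK.
Qed.

Lemma Def_ltn (a b : (nat -> R) -> nat) :
  DefN a -> DefN b -> Def M (fun e => (a e < b e)%N).
Proof.
move=> Da Db.
pose prec x y := exists m n, [/\ (m < n)%N, x = d m & y = d n].
apply: Def_ext (Def_subst2 (P := prec) Def_prec Da Db) => e.
split=> [[m [n [mn /d_inj -> /d_inj ->]]]//|ab].
by exists (a e), (b e).
Qed.

Lemma Def_leq (a b : (nat -> R) -> nat) :
  DefN a -> DefN b -> Def M (fun e => (a e <= b e)%N).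
Proof.
move=> Da Db; apply: Def_ext (Def_not (Def_ltn Db Da)) => e.
by split=> [/negP|ab]; [|apply/negP]; rewrite -leqNgt.
Qed.

End Indices.

(** Definability is proved by recursion on the shape of the predicate. Quantifiers over [nat] are
    tried before those over reals, and strict comparison of indices before the weak one of which it
    is an instance. *)
Ltac def_step dinj dprec :=
  lazymatch goal with
  | |- Def _ (fun _ => ~ _) => apply: Def_not
  | |- Def _ (fun _ => _ /\ _) => apply: Def_and
  | |- Def _ (fun _ => @ex nat _) => apply: (Def_existsN dinj)
  | |- Def _ (fun _ => @ex _ _) => apply: Def_exists
  | |- Def _ (fun _ => forall _ : nat, _) => apply: (Def_forallN dinj)
  | |- Def _ (fun _ => _ -> _) => apply: Def_imply
  | |- Def _ (fun _ => is_true (leq (S _) _)) => apply: (Def_ltn dinj dprec)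
  | |- Def _ (fun _ => is_true (leq _ _)) => apply: (Def_leq dinj dprec)
  | |- Def _ (fun _ => is_true (_ < _)) => apply: Def_lt
  | |- Def _ (fun _ => _ = _) => apply: Def_eq
  | |- DefT _ (fun _ => _ + _) => apply: DefT_add
  | |- DefT _ (fun _ => - _) => apply: DefT_opp
  | |- DefT _ (fun _ => _ *+ _) => apply: DefT_mulrn
  | |- DefT _ (fun _ => ?c) => exact: DefT_const
  | |- DefT _ (fun e => e _) => exact: DefT_var
  | |- DefT _ (fun _ => _ _) => apply: DefT_d
  | |- DefN _ _ (fun _ => idx _ _) => apply: (DefN_idx dinj dprec)
  | |- DefN _ _ (fun _ => ?c) => exact: DefN_const
  end.

(** * The order in which the tests are made *)

Section Schedule.
Context (len : nat -> nat).

(* Enumerates the pairs (b, r) with r <= len b in lexicographic order. *)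
Fixpoint schedule (i : nat) : nat * nat :=
  if i is j.+1 then
    let: (b, r) := schedule j in
    if (r < len b)%N then (b, r.+1) else (b.+1, 0%N)
  else (0%N, 0%N).

Lemma schedule_group (i b : nat) : schedule i = (b, 0%N) ->
  forall r, (r <= len b)%N -> schedule (i + r) = (b, r).
Proof.
move=> ib; elim=> [|r IH] rb; first by rewrite addn0.
by rewrite addnS /= IH ?rb // ltnW.
Qed.

Lemma schedule_next (i b : nat) : schedule i = (b, 0%N) ->
  schedule (i + len b).+1 = (b.+1, 0%N).
Proof. by move=> /schedule_group /= ->; rewrite ?ltnn. Qed.

Lemma schedule_start (b : nat) : exists i, schedule i = (b, 0%N).
Proof.
elim: b => [|b [i /schedule_next ib]]; first by exists 0%N.
by exists (i + len b).+1.
Qed.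

End Schedule.

(** * Separating two points by increments of the function *)

Section Separation.
Context {R : realType} (F : R -> R) (al be : R).
Context (F_cont : forall x, al < x -> x < be -> forall eps : R, 0 < eps ->
  exists r : R, 0 < r /\ forall x', `|x' - x| < r -> `|F x' - F x| < eps).
Context (F_sep : forall x x', al < x -> x < be -> al < x' -> x' < be ->
  x <> x' -> forall eta : R, 0 < eta ->
  exists w : R, [/\ 0 < w, w < eta & F (x + w) - F x <> F (x' + w) - F x']).

Lemma separating_box (x x' eta : R) : al < x -> x < be -> 0 < eta ->
  exists w0 l0 h0 r, [/\ 0 < r, `|w0| < eta, `|l0| < eta & `|h0| < eta] /\
    forall w l h, `|w - w0| < r -> `|l - l0| < r -> `|h - h0| < r ->
    [/\ l < F (x + w) - F x, F (x + w) - F x < h &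
      al < x' -> x' < be -> x' <> x ->
      ~ (l < F (x' + w) - F x' /\ F (x' + w) - F x' < h)].
Proof.
move=> alx xbe eta0.
have [|r1 [r1_gt0 Hr1]] := F_cont alx xbe (eps := eta / 4); first lra.
have [[alx' [x'be nx]]|triv] := pselect (al < x' /\ x' < be /\ x' <> x); last first.
  (* There is nothing to separate from, so the increment may be near 0, with bounds that only [x]
     has to meet. *)
  exists 0, (- (eta / 2)), (eta / 2), (Order.min r1 (eta / 4)); split.
    split; first by rewrite lt_min r1_gt0; lra.
    - by rewrite normr0.
    - by rewrite normrN ger0_norm; lra.
    - by rewrite ger0_norm; lra.
  move=> w l h; rewrite !lt_min subr0 !ltr_norml => /andP[h1 _] /andP[_ h2] /andP[_ h3].
  have := Hr1 (x + w); rewrite (_ : x + w - x = w); last lra.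
  rewrite ltr_norml => /(_ h1); rewrite ltr_norml => h4.
  by split; [lra|lra|move=> ? ? ?; case: triv].
(* The increment is also kept below [be - x] and [be - x'], so that continuity is available at the
   shifted points. *)
have [|w0 [w0_gt0]] := F_sep alx xbe alx' x'be (nesym nx)
    (eta := Order.min (Order.min r1 eta) (Order.min (be - x) (be - x'))).
  by rewrite !lt_min r1_gt0 eta0 !subr_gt0 xbe x'be.
rewrite !lt_min => /andP[/andP[w0r1 w0eta] /andP[w0x w0x']].
have := Hr1 (x + w0); rewrite (_ : x + w0 - x = w0); last lra.
rewrite (gtr0_norm w0_gt0) => /(_ w0r1).
set g := F (x + w0) - F x; set g' := F (x' + w0) - F x' => geta gg'.
(* The window of half-width [kap] about [g] misses [g'] by at least [kap], which absorbs the
   perturbations of size [kap / 4]; the cap [eta / 4] keeps the bounds small. *)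
pose kap := Order.min (`|g - g'| / 2) (eta / 4).
have gg'0 : 0 < `|g - g'| by rewrite normr_gt0 subr_eq0; apply/eqP.
have kap0 : 0 < kap by rewrite lt_min; apply/andP; split; lra.
have kap1 : kap <= `|g - g'| / 2 by rewrite ge_min lexx.
have kap2 : kap <= eta / 4 by rewrite ge_min lexx orbT.
have [| | |r2 [r2_gt0 Hr2]] := @F_cont (x + w0) _ _ (kap / 4); [lra|lra|lra|].
have [| | |r3 [r3_gt0 Hr3]] := @F_cont (x' + w0) _ _ (kap / 4); [lra|lra|lra|].
exists w0, (g - kap), (g + kap), (Order.min (Order.min r2 r3) (kap / 4)); split.
  rewrite ltr_norml in geta.
  split; first by rewrite !lt_min r2_gt0 r3_gt0; lra.
  - by rewrite gtr0_norm.
  - by rewrite ltr_norml; lra.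
  - by rewrite ltr_norml; lra.
move=> w l h; rewrite !lt_min => /andP[/andP[h1 h2] _] /andP[_ h3] /andP[_ h4].
have := Hr2 (x + w); rewrite (_ : x + w - _ = w - w0); last lra.
move=> /(_ h1); have := Hr3 (x' + w); rewrite (_ : x' + w - _ = w - w0); last lra.
move=> /(_ h2); rewrite !ltr_norml in h3 h4 * => h5 h6.
rewrite /g in h3 h4.
split; [lra|lra|move=> _ _ _ [h7 h8]].
suff : `|g - g'| < 2 * kap by lra.
by rewrite ltr_norml /g /g'; lra.
Qed.

End Separation.

(** * Compact sets in coordinates *)

Lemma compact_coord_bound (R : realType) (k : nat) (K : set 'rV[R]_k) :
  compact K -> exists m : R, 0 < m /\ forall v, K v -> forall j, `|v 0 j| < m.
Proof.
move=> /compact_bounded[N [Nr HN]]; exists (`|N| + 2); split.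
  by have := normr_ge0 N; lra.
move=> v Kv j; have NN : N < `|N| + 1 by have := ler_norm N; lra.
have vN : ball (0 : 'rV[R]_k) (`|N| + 2) v.
  rewrite -ball_normE /ball_ /= sub0r normrN.
  by have := HN _ NN v Kv => /=; lra.
case: vN => _ /(_ 0 j).
by rewrite -ball_normE /ball_ /= mxE sub0r normrN.
Qed.

Lemma compact_compl_box (R : realType) (k : nat) (K : set 'rV[R]_k)
    (v : 'rV[R]_k) : compact K -> ~ K v ->
  exists r : R, 0 < r /\ forall w : 'rV[R]_k, (forall j, `|v 0 j - w 0 j| < r) -> ~ K w.
Proof.
move=> cK nKv.
have oK : open (~` K) by rewrite openC; exact: compact_closed (@norm_hausdorff _ _) cK.
have /nbhs_ballP[r /= r0 Hr] : nbhs v (~` K) by exact: open_nbhs_nbhs.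
exists r; split=> // w Hw; apply: Hr; split=> // i j.
by rewrite (ord1 i) -ball_normE; exact: Hw.
Qed.

(** * Decoding sequences and defining compact sets *)

Section Decoding.
Context {R : realType} (M : expansion R) (d : nat -> R) (d_inj : injective d).
Context (Def_prec : Def M (fun e =>
  exists m n, [/\ (m < n)%N, e 0%N = d m & e 1%N = d n])).
Context (al be : R) (albe : al < be).
Context (d_dense : forall x y, al <= x -> x < y -> y <= be ->
  exists n, x < d n /\ d n < y).
Context (F : R -> R) (Def_F : Def M (fun e => e 0%N = F (e 1%N))).
Context (F_cont : forall x, al < x -> x < be -> forall eps : R, 0 < eps ->
  exists r : R, 0 < r /\ forall x', `|x' - x| < r -> `|F x' - F x| < eps).
Context (F_sep : forall x x', al < x -> x < be -> al < x' -> x' < be ->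
  x <> x' -> forall eta : R, 0 < eta ->
  exists w : R, [/\ 0 < w, w < eta & F (x + w) - F x <> F (x' + w) - F x']).

Definition in_stage (t : R) (n0 m : nat) : Prop :=
  (n0 <= m)%N /\ right_approx d t m.

Definition starts (v : R) (m : nat) : Prop := exists z, reading d m v z /\ 0 < z.

(** The flag [v] cuts the stages into groups: from [m], the group runs until just before the next
    stage with positive flag. *)
Definition in_group (t : R) (n0 : nat) (v : R) (m m' : nat) : Prop :=
  in_stage t n0 m' /\ (m <= m')%N /\
  forall m2, in_stage t n0 m2 -> (m < m2)%N -> (m2 <= m')%N -> ~ starts v m2.

Definition test (u l h : R) (m k : nat) : Prop :=
  exists zu, reading d m u zu /\ exists zl, reading d m l zl /\
  exists zh, reading d m h zh /\
    (zl < F (d k + zu) - F (d k) /\ F (d k + zu) - F (d k) < zh).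

Definition passes (t : R) (n0 : nat) (v u l h : R) (m k : nat) : Prop :=
  forall m', in_group t n0 v m m' -> test u l h m' k.

(** Asking for the first index that passes is what makes finitely many tests enough: only its
    predecessors have to fail one. *)
Definition codes (t : R) (n0 : nat) (v u l h : R) (m k : nat) : Prop :=
  al < d k /\ d k < be /\ passes t n0 v u l h m k /\
  forall k', (k' < k)%N -> al < d k' -> d k' < be ->
    ~ passes t n0 v u l h m k'.

Lemma codes_uniq (t : R) (n0 : nat) (v u l h : R) (m k k' : nat) :
  codes t n0 v u l h m k -> codes t n0 v u l h m k' -> k = k'.
Proof.
move=> [a1 [a2 [a3 a4]]] [b1 [b2 [b3 b4]]].
by case: (ltngtP k k') => // kk'; [case: (b4 k)|case: (a4 k')].
Qed.

Lemma DefT_F (x : (nat -> R) -> R) : DefT M x -> DefT M (fun e => F (x e)).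
Proof. exact: DefT_graph1. Qed.

Lemma Def_starts (t : R) (n0 : nat) (v : R) :
  Def M (fun e => in_stage t n0 (idx d (e 0%N)) /\ starts v (idx d (e 0%N))).
Proof.
rewrite /in_stage /starts /right_approx /reading.
repeat def_step d_inj Def_prec.
Qed.

Lemma Def_codes (t : R) (n0 : nat) (v u l h : R) :
  Def M (fun e => codes t n0 v u l h (idx d (e 0%N)) (idx d (e 1%N))).
Proof.
rewrite /codes /passes /in_group /test /in_stage /starts /right_approx /reading.
repeat first [match goal with |- DefT _ (fun _ => F _) => apply: DefT_F end
  | def_step d_inj Def_prec].
Qed.

Section Sequence.
Context (C : finType) (bet : nat -> C -> nat).
Context (bet_in : forall b c, al < d (bet b c) /\ d (bet b c) < be).

(** The stage [r] of group [b] rules out the index [r], for all [c] at once, so the group must reach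
    the largest target. *)
Let len (b : nat) : nat := \max_c bet b c.

Let steps : nat -> nat * nat := schedule len.

(* Coordinates of a stage: None is the flag, Some (c, None) the increment of F,
   Some (c, Some false) and Some (c, Some true) the bounds it is tested for. *)
Definition requirement (i : nat) (z : option (C * option bool) -> R) : Prop :=
  (if (steps i).2 == 0%N then 0 < z None else z None < 0) /\
  forall c, let x := d (bet (steps i).1 c) in let x' := d (steps i).2 in
    let w := z (Some (c, None)) in
    let l := z (Some (c, Some false)) in let h := z (Some (c, Some true)) in
    [/\ l < F (x + w) - F x, F (x + w) - F x < h &
      al < x' -> x' < be -> x' <> x ->
      ~ (l < F (x' + w) - F x' /\ F (x' + w) - F x' < h)].

(** Different [c] use different coordinates, so their separating boxes can be multiplied; the flag
    is centred at plus or minus [eta / 2]. *)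
Lemma requirement_boxes (i : nat) : boxes_near0 (requirement i).
Proof.
move=> eta eta0; case Ei: (steps i) => [b r].
have /choice[f Hf] : forall c, exists q : R * R * R * R,
    [/\ 0 < q.2, `|q.1.1.1| < eta, `|q.1.1.2| < eta & `|q.1.2| < eta] /\
    let x := d (bet b c) in let x' := d r in
    forall w l h, `|w - q.1.1.1| < q.2 -> `|l - q.1.1.2| < q.2 -> `|h - q.1.2| < q.2 ->
    [/\ l < F (x + w) - F x, F (x + w) - F x < h &
      al < x' -> x' < be -> x' <> x ->
      ~ (l < F (x' + w) - F x' /\ F (x' + w) - F x' < h)].
  move=> c; have [h1 h2] := bet_in b c.
  have [w0 [l0 [h0 [r0 H]]]] := separating_box F_cont F_sep (d r) h1 h2 eta0.
  by exists (w0, l0, h0, r0).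
have [rho [rho0 Hrho]] : exists rho : R, 0 < rho /\ forall c, rho <= (f c).2.
  by apply: finite_pos_lower_bound => c; case: (Hf c) => -[].
pose z0 (j : option (C * option bool)) : R :=
  match j with
  | None => if r == 0%N then eta / 2 else - (eta / 2)
  | Some (c, None) => (f c).1.1.1
  | Some (c, Some false) => (f c).1.1.2
  | Some (c, Some true) => (f c).1.2
  end.
exists z0, (Order.min rho (eta / 2)); split.
- by rewrite lt_min rho0; lra.
- case=> [[c [[]|]]|] /=; try by case: (Hf c) => -[].
  by case: ifP => _; rewrite ?normrN gtr0_norm; lra.
- move=> z Hz; rewrite /requirement Ei /=; split.
    have := Hz None; rewrite lt_min => /andP[_]; rewrite ltr_norml /= => /andP[h1 h2].
    by case: ifP h1 h2 => _ h1 h2; lra.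
  move=> c; have [_ H] := Hf c; apply: H.
  + by apply: lt_le_trans (Hrho c);
      have := Hz (Some (c, None)); rewrite lt_min => /andP[].
  + by apply: lt_le_trans (Hrho c);
      have := Hz (Some (c, Some false)); rewrite lt_min => /andP[].
  + by apply: lt_le_trans (Hrho c);
      have := Hz (Some (c, Some true)); rewrite lt_min => /andP[].
Qed.

(** [St] marks the stages that open a group, and [P] decodes the tuple of that group. The number [b]
    itself is not recovered: it suffices that the tuples decoded over [St] are exactly those of the
    sequence. *)
Lemma coded_sequence : exists (St : nat -> Prop) (P : C -> nat -> nat -> Prop),
  [/\ Def M (fun e => St (idx d (e 0%N))),
      forall c, Def M (fun e => P c (idx d (e 0%N)) (idx d (e 1%N))),
      forall m, St m -> exists b, forall c k, P c m k <-> k = bet b c &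
      forall b, exists m, St m /\ forall c k, P c m k <-> k = bet b c].
Proof.
have [t [y [n [n_lt n_right n_read]]]] := coding albe d_inj d_dense requirement_boxes.
have n_mono : {mono n : i j / (i <= j)%N}.
  by apply: leq_mono => i j ij; apply: (homo_ltn ltn_trans n_lt).
have n_mono_lt : {mono n : i j / (i < j)%N} by exact: leqW_mono.
pose u c := y (Some (c, None)); pose v := y None.
pose l c := y (Some (c, Some false)); pose h c := y (Some (c, Some true)).
have stageP m : in_stage t (n 0%N) m <-> exists i, m = n i.
  split=> [[n0m /n_right]|[i ->]]; first exact.
  have n0i : (n 0 <= n i)%N by rewrite n_mono.
  by split=> //; apply/n_right => //; exists i.
have startsP i : starts v (n i) <-> (steps i).2 = 0%N.
  have [z [[Hz _] Hr]] := n_read i; split.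
    move=> [z' [/(reading_uniq (Hr None)) <- z0]].
    by case: eqP Hz => // _; rewrite (lt_gtF z0).
  by move=> E; exists (z None); split; [exact: Hr|rewrite E in Hz].
have groupP i b : steps i = (b, 0%N) -> forall m', in_group t (n 0%N) v (n i) m' <->
    exists2 r, (r <= len b)%N & m' = n (i + r)%N.
  move=> Ei m'; split.
    move=> [/stageP[i' ->] [+ H]]; rewrite n_mono => ii'.
    (* Group [b] cannot extend past [i + len b], since the next stage carries the flag of group
       [b.+1]. *)
    have i'b : (i' <= i + len b)%N.
      rewrite leqNgt; apply/negP => lt.
      apply: (H (n (i + len b).+1)); first by apply/stageP; exists (i + len b).+1.
      - by rewrite n_mono_lt ltnS leq_addr.
      - by rewrite n_mono.
      - by apply/startsP; rewrite /steps (schedule_next Ei).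
    exists (i' - i)%N; first by rewrite leq_subLR.
    by rewrite subnKC.
  move=> [r rb ->]; split; [by apply/stageP; exists (i + r)%N|split].
    by rewrite n_mono leq_addr.
  move=> m2 /stageP[i2 ->]; rewrite n_mono n_mono_lt => ii2 i2r /startsP.
  rewrite -(subnKC (ltnW ii2)) /steps (schedule_group Ei) /=; lia.
have /choice[z Hz] := n_read.
have testP c i k : test (u c) (l c) (h c) (n i) k <->
    (z i (Some (c, Some false)) < F (d k + z i (Some (c, None))) - F (d k) /\
     F (d k + z i (Some (c, None))) - F (d k) < z i (Some (c, Some true))).
  have [_ Hr] := Hz i; split.
    move=> [zu [/(reading_uniq (Hr _)) <- [zl [/(reading_uniq (Hr _)) <-]]]].
    by move=> [zh [/(reading_uniq (Hr _)) <-]].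
  move=> H; exists (z i (Some (c, None))); split; first exact: Hr.
  exists (z i (Some (c, Some false))); split; first exact: Hr.
  by exists (z i (Some (c, Some true))); split; first exact: Hr.
have codesP i b c : steps i = (b, 0%N) ->
    codes t (n 0%N) v (u c) (l c) (h c) (n i) (bet b c).
  move=> Ei; have [h1 h2] := bet_in b c; split=> //; split=> //; split.
    move=> m' /(groupP _ _ Ei)[r rb ->]; apply/testP.
    have [[_ Hrc] _] := Hz (i + r)%N; move: (Hrc c).
    by rewrite /steps (schedule_group Ei) //= => -[].
  (* An earlier index [k'] is at most [len b], so stage [i + k'] of the group was devoted to
     rejecting it. *)
  move=> k' k'b h3 h4 /(_ (n (i + k')%N)).
  have k'len : (k' <= len b)%N.
    by apply: leq_trans (ltnW k'b) _; exact: (leq_bigmax c).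
  have [[_ Hrc] _] := Hz (i + k')%N; move: (Hrc c).
  rewrite /steps (schedule_group Ei) //= => -[_ _ H] H'.
  apply: H => //; first by move=> /d_inj E; rewrite E ltnn in k'b.
  by apply/testP; apply: H'; apply/(groupP _ _ Ei); exists k'.
have decode i b : steps i = (b, 0%N) -> forall c k,
    codes t (n 0%N) v (u c) (l c) (h c) (n i) k <-> k = bet b c.
  move=> Ei c k; split=> [H|->]; last exact: codesP.
  exact: codes_uniq H (codesP _ _ _ Ei).
exists (fun m => in_stage t (n 0%N) m /\ starts v m).
exists (fun c => codes t (n 0%N) v (u c) (l c) (h c)); split.
- exact: Def_starts.
- by move=> c; exact: Def_codes.
- move=> _ [/stageP[i ->] /startsP Ei]; exists (steps i).1.
  by apply: decode; rewrite -Ei; case: (steps i).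
- move=> b; have [i Ei] := schedule_start len b; exists (n i).
  split; last exact: decode.
  by split; [apply/stageP; exists i|apply/startsP; rewrite /steps Ei].
Qed.

End Sequence.
(** Inside a large open box the complement of [K] is a union of boxes with corners in a rescaled
    copy of the sequence. These are countably many, so their list can be coded. *)
Lemma compact_definable (k : nat) (K : set 'rV[R]_k) :
  compact K -> definable M K.
Proof.
case: k K => [|k] K cK.
  apply: definable_of_Def; apply: Def_ext (Def_const M (K 0)) => e.
  by rewrite (_ : \row_j _ = 0) //; apply/rowP => -[].
have [m [m0 Km]] := compact_coord_bound cK.
have [N HN] : exists N : nat, m + m < (be - al) *+ N.
  exists (Num.truncn ((m + m) / (be - al))).+1.
  rewrite -mulr_natr mulrC -ltr_pdivrMr ?subr_gt0 //.
  by rewrite truncnS_gt // divr_ge0 ?subr_ge0 ?ltW // addr_gt0.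
have N0 : (0 < N)%N by case: N HN => //; rewrite mulr0n; lra.
(* The dilation factor is a natural number so that [L] is definable from addition; [L] stretches the
   interval from [al] to [be] over all coordinates of points of [K]. *)
pose L x := x *+ N - al *+ N - m.
have L_lt x y : (L x < L y) = (x < y).
  by rewrite /L !ltrD2r ltrMn2r N0.
have Lal : L al = - m by rewrite /L; lra.
have Lbe : m < L be by rewrite /L; move: HN; rewrite mulrnBl; lra.
have Ldense x y : L al <= x -> x < y -> y <= L be ->
    exists n, [/\ al < d n, d n < be, x < L (d n) & L (d n) < y].
  pose L' x := (x + m) / N%:R + al.
  have L'K z : L (L' z) = z.
    rewrite /L /L' mulrnDl -[(z + m) / N%:R *+ N]mulr_natr
      divfK ?pnatr_eq0 -?lt0n //; lra.
  move=> ax xy yb; rewrite -(L'K x) -(L'K y).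
  have xy' : L' x < L' y by rewrite -L_lt !L'K.
  have ax' : al <= L' x by rewrite leNgt -L_lt L'K -leNgt.
  have yb' : L' y <= be by rewrite leNgt -L_lt L'K -leNgt.
  have [n [h1 h2]] := d_dense ax' xy' yb'.
  by exists n; rewrite !L_lt; split=> //; lra.
pose C : finType := (bool * 'I_k.+1)%type.
pose in_box (tau : C -> nat) (v : 'rV[R]_k.+1) := forall j,
  L (d (tau (false, j))) < v 0 j /\ v 0 j < L (d (tau (true, j))).
pose valid (tau : C -> nat) := (forall c, al < d (tau c) /\ d (tau c) < be) /\
  forall v, K v -> ~ in_box tau v.
have [k0 [k01 k02]] := d_dense (lexx al) albe (lexx be).
(* This enumerates the corner tuples of boxes disjoint from [K]. Other codes are sent to a constant
   tuple, whose box is empty. *)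
pose bet (b : nat) : C -> nat :=
  let tau : C -> nat :=
    if unpickle b is Some g then fun c => (g : {ffun C -> nat}) c else fun=> k0 in
  if `[< valid tau >] then tau else fun=> k0.
have valid0 : valid (fun=> k0).
  split=> // v _ /(_ ord0)[h1 h2]; by have := lt_trans h1 h2; rewrite ltxx.
have bet_valid b : valid (bet b).
  by rewrite /bet; case: asboolP.
have bet_surj tau : valid tau -> exists b, forall c, bet b c = tau c.
  move=> vt; exists (pickle [ffun c => tau c]) => c; rewrite /bet pickleK.
  case: asboolP => [_|[]]; first by rewrite ffunE.
  case: vt => h1 h2; split=> [c'|v Kv]; first by rewrite ffunE; exact: h1.
  by move=> H; apply: (h2 v Kv) => j; have := H j; rewrite !ffunE.
have [St [P [DSt DP St1 St2]]] := coded_sequence (fun b c => (bet_valid b).1 c).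
apply: definable_of_Def.
apply: (@Def_ext _ _ (fun e => (forall j : 'I_k.+1, L al < e j /\ e j < L be) /\
  ~ exists n, St n /\ forall j : 'I_k.+1,
    exists a, P (false, j) n a /\ exists b, P (true, j) n b /\
      (L (d a) < e j /\ e j < L (d b)))).
  move=> e; set v := \row_j _.
  have ve j : e (nat_of_ord j) = v 0 j by rewrite mxE.
  split=> [[eL nbox]|Kv].
    apply: contrapT => nKv; apply: nbox.
    (* Corners within [r] of [v] on both sides, in every coordinate, give a valid box around [v]. *)
    have [r [r0 Hr]] := compact_compl_box cK nKv.
    have /choice[tau1 Ht1] : forall j : 'I_k.+1, exists n,
        [/\ al < d n, d n < be, v 0 j - r < L (d n) & L (d n) < v 0 j].
      move=> j; have [] := eL j; rewrite ve => h1 h2.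
      have [| | |n [h3 h4 h5 h6]] := Ldense (Order.max (L al) (v 0 j - r)) (v 0 j).
      - by rewrite le_max lexx.
      - by rewrite gt_max h1; lra.
      - exact: ltW.
      - by exists n; split=> //; move: h5; rewrite gt_max => /andP[].
    have /choice[tau2 Ht2] : forall j : 'I_k.+1, exists n,
        [/\ al < d n, d n < be, v 0 j < L (d n) & L (d n) < v 0 j + r].
      move=> j; have [] := eL j; rewrite ve => h1 h2.
      have [| | |n [h3 h4 h5 h6]] := Ldense (v 0 j) (Order.min (L be) (v 0 j + r)).
      - exact: ltW.
      - by rewrite lt_min h2; lra.
      - by rewrite ge_min lexx.
      - by exists n; split=> //; move: h6; rewrite lt_min => /andP[].
    pose tau (c : C) := if c.1 then tau2 c.2 else tau1 c.2.
    have vt : valid tau.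
      split=> [[[] j]|w Kw box]; first by case: (Ht2 j).
        by case: (Ht1 j).
      apply: (Hr w) => // j; have [h1 h2] := box j.
      have [_ _ h3 h4] := Ht1 j; have [_ _ h5 h6] := Ht2 j.
      by rewrite /tau /= in h1 h2; rewrite ltr_norml; lra.
    have [b Hb] := bet_surj _ vt.
    have [n [Stn Hn]] := St2 b; exists n; split=> // j.
    exists (tau1 j); split; first by apply/Hn; rewrite Hb.
    exists (tau2 j); split; first by apply/Hn; rewrite Hb.
    by rewrite ve; case: (Ht1 j) => _ _ _ ?; case: (Ht2 j).
  split=> [j|[n [Stn Hn]]].
    by have := Km v Kv j; rewrite ve ltr_norml Lal => h; lra.
  have [b Hb] := St1 n Stn.
  apply: ((bet_valid b).2 v Kv) => j.
  have [a1 [/Hb -> [a2 [/Hb -> ]]]] := Hn j.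
  by rewrite ve.
apply: Def_and.
  by apply: Def_forall_fin => j; rewrite /L; repeat def_step d_inj Def_prec.
apply: Def_not; apply: (Def_existsN d_inj); apply: Def_and; first exact: DSt.
apply: Def_forall_fin => j; apply: (Def_existsN d_inj); apply: Def_and.
  by apply: (Def_substN d_inj (DP _)); exact: DefN_idx.
apply: (Def_existsN d_inj); apply: Def_and.
  by apply: (Def_substN d_inj (DP _)); exact: DefN_idx.
by rewrite /L; repeat def_step d_inj Def_prec.
Qed.

End Decoding.

(** * Bringing the hypotheses into the required form *)

Lemma open_interval_sub (R : realType) (J : set R) : open_interval J ->
  exists x y, x < y /\ forall z, x < z -> z < y -> J z.
Proof.
move=> [_ oJ [c Jc]]; have /nbhs_ballP[r /= r0 Hr] : nbhs c J by exact: open_nbhs_nbhs.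
exists (c - r), (c + r); split=> [|z h1 h2]; first lra.
by apply: Hr; rewrite -ball_normE /ball_ /= ltr_norml; lra.
Qed.

Lemma somewhere_dense_sub (R : realType) (D : set R) : somewhere_dense D ->
  exists al be, al < be /\ forall x y, al <= x -> x < y -> y <= be ->
    exists z, [/\ D z, x < z & z < y].
Proof.
move=> [J [oJ JD]]; have [al [be [albe HJ]]] := open_interval_sub oJ.
exists al, be; split=> // x y ax xy yb.
have /JD : J ((x + y) / 2) by apply: HJ; lra.
move=> /(_ `]x, y[%classic) [|z [[Dz _]]].
  by apply: near_in_itvoo; rewrite in_itv /=; lra.
by rewrite /= in_itv /= => /andP[]; exists z.
Qed.

(** This excludes the finite alternative for a somewhere dense set. Each point of the list inside
    the current interval cuts it down to the part on its right. *)
Lemma seq_avoiding_interval (R : realType) (s : seq R) (x y : R) : x < y ->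
  exists x' y', [/\ x <= x', x' < y', y' <= y &
    forall z, z \in s -> ~ (x' < z /\ z < y')].
Proof.
move=> xy; elim: s => [|a s [x' [y' [xx' x'y' y'y H]]]]; first by exists x, y.
have [/andP[x'a ay']|na] := boolP (x' < a < y').
  exists a, y'; split=> //; first lra.
  move=> z; rewrite inE => /orP[/eqP -> [h1 h2]|/H nz [h1 h2]].
    by rewrite ltxx in h1.
  by apply: nz; split=> //; lra.
exists x', y'; split=> // z; rewrite inE => /orP[/eqP -> [h1 h2]|/H//].
by move: na; rewrite h1 h2.
Qed.

(** The set [D] need not be dense near the interval where [f] fails to be repetitious, so [f] is
    translated to where [D] is dense; extension by 0 gives a total function. *)
Definition shift_total {R : realType} (a b q : R) (f : R -> R) (x : R) : R :=
  if a < x + q < b then f (x + q) else 0.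

Lemma Def_shift_total (R : realType) (M : expansion R) (a b q : R) (f : R -> R) :
  definable_fun M `]a, b[ f -> Def M (fun e => e 0%N = shift_total a b q f (e 1%N)).
Proof.
move=> /Def_of_definable Df.
pose G x z := (a < x /\ x < b) /\ z = f x.
have DG : Def M (fun e => G (e 0%N) (e 1%N)).
  apply: Def_ext Df => e; rewrite /= !mxE /= in_itv /=.
  by split=> -[] => [/andP[]|[-> ->]].
apply: (@Def_ext _ _ (fun e => G (e 1%N + q) (e 0%N) \/
    (~ (a < e 1%N + q /\ e 1%N + q < b) /\ e 0%N = 0))).
  move=> e; rewrite /G /shift_total.
  case: (boolP (a < e 1%N + q < b)) => [/andP[h1 h2]|/negP nh].
    by split=> [[[]//|[[]]]|]; [|left].
  by split=> [[[[h1 h2] _]|[]//]|]; [case: nh; rewrite h1 h2|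
    right; split=> // -[h1 h2]; apply: nh; rewrite h1 h2].
apply: Def_or.
  by apply: (Def_subst2 DG); [apply: DefT_add; [exact: DefT_var|exact: DefT_const]
    |exact: DefT_var].
apply: Def_and; last by apply: Def_eq; [exact: DefT_var|exact: DefT_const].
apply: Def_not; apply: Def_and; apply: Def_lt; try exact: DefT_const;
  by apply: DefT_add; [exact: DefT_var|exact: DefT_const].
Qed.

Lemma omega_orderable_enum (R : realType) (M : expansion R) (D : set R) :
  omega_orderable M (line D) -> somewhere_dense D ->
  exists d : nat -> R, [/\ injective d, forall x, D x <-> exists n, x = d n &
    Def M (fun e => exists m n, [/\ (m < n)%N, e 0%N = d m & e 1%N = d n])].
Proof.
move=> [/Def_of_definable DD ord] /somewhere_dense_sub[al [be [albe dense]]].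
case: ord => [/finite_seqP[s Ds]|
    [E [/Def_of_definable DE [g [[g_in g_inj g_surj] gE]]]]].
  have [x [y [ax xy yb H]]] :=
    seq_avoiding_interval [seq v 0 0 | v : 'rV[R]_1 <- s] albe.
  have [z [Dz xz zy]] := dense x y ax xy yb.
  exfalso; apply: (H z) => //; apply/mapP.
  exists (const_mx z); last by rewrite mxE.
  have : line D (const_mx z) by rewrite /line /= mxE.
  by rewrite Ds.
pose d n := g n 0 0.
have gd n : g n = const_mx (d n) by apply/rowP => j; rewrite (ord1 j) mxE.
have DP x : D x <-> exists n, x = d n.
  split=> [Dx|[n ->]]; last by have := g_in n I.
  have [|n _ gn] := g_surj (const_mx x); first by rewrite /line /= mxE.
  by exists n; rewrite /d gn mxE.
exists d; split=> //.
  by move=> m n dmn; apply: g_inj; rewrite ?inE // !gd dmn.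
have D0 : Def M (fun e => D (e 0%N)).
  by apply: Def_ext DD => e; rewrite /line /= mxE.
have D1 : Def M (fun e => D (e 1%N)) by exact: (Def_rename S D0).
(* The relation [E] is known only on [D], so both variables are confined to [D]. *)
apply: Def_ext (Def_and D0 (Def_and D1 DE)) => e.
have row_d m n : e 0%N = d m -> e 1%N = d n ->
    \row_(j < 1 + 1) e j = row_mx (g m) (g n).
  move=> em en; apply/rowP => j; rewrite !mxE.
  by case: splitP => l -> ; rewrite (ord1 l) /= ?em ?en.
split.
  move=> [/DP[m em] [/DP[n en]]]; rewrite (row_d m n em en) => /gE mn.
  by exists m, n.
move=> [m [n [mn em en]]]; split; [|split].
- by apply/DP; exists m.
- by apply/DP; exists n.
- by rewrite (row_d m n em en); apply/gE.
Qed.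

Theorem theoremD (R : realType) (M : expansion R) (hB : type_B M)
    (a b : R) (hab : a < b) (f : R -> R)
    (hf : {within `]a, b[, continuous f})
    (hdef : definable_fun M `]a, b[ f) :
  repetitious `]a, b[ f.
Proof.
move: hB => [[D [oD sD]] [k [K [cK nK]]]] J oJ JI.
apply: contrapT => nrep; apply: nK.
have [al [be1 [albe1 dense]]] := somewhere_dense_sub sD.
have [j1 [j2 [j12 Jsub]]] := open_interval_sub oJ.
have [d [d_inj Dd Dprec]] := omega_orderable_enum oD sD.
(* The interval from [al] to [be] stays where [D] is dense, and its translate by [q] stays between
   [j1] and [j2]. *)
pose be := al + Order.min (be1 - al) (j2 - j1); pose q := j1 - al.
have albe : al < be by rewrite /be ltrDl lt_min !subr_gt0 albe1 j12.
have bebe1 : be <= be1 by rewrite -lerBrDl ge_min lexx.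
have bej2 : be + q <= j2.
  have : Order.min (be1 - al) (j2 - j1) <= j2 - j1 by rewrite ge_min lexx orbT.
  by rewrite /be /q; lra.
have inJ x : al < x -> x < be -> J (x + q).
  by move=> h1 h2; apply: Jsub; rewrite /q in bej2 *; lra.
have inab x : al < x -> x < be -> a < x + q < b.
  by move=> h1 h2; have := JI _ (inJ _ h1 h2); rewrite /= in_itv.
have FE x : a < x + q < b -> shift_total a b q f x = f (x + q).
  by rewrite /shift_total => ->.
apply: (compact_definable d_inj Dprec albe _ (Def_shift_total q hdef)) cK.
- move=> x y ax xy yb; have [|z [/Dd[n ->] h1 h2]] := dense x y ax xy.
    exact: le_trans bebe1.
  by exists n.
- move=> x alx xbe eps eps0; have xab := inab x alx xbe.
  rewrite continuous_open_subspace in hf; last exact: interval_open.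
  have /hf/cvgrPdist_lt/(_ eps eps0)/nbhs_ballP[r /= r0 Hr] :
      x + q \in `]a, b[%classic by rewrite inE /= in_itv.
  move/andP: (xab) => [xa xb].
  exists (Order.min r (Order.min (x + q - a) (b - (x + q)))); split.
    by rewrite !lt_min r0 !subr_gt0 xa xb.
  move=> x'; rewrite !lt_min => /andP[h1 /andP[h2 h3]].
  rewrite ltr_norml in h2; rewrite ltr_norml in h3.
  rewrite !FE //; last by apply/andP; split; lra.
  rewrite distrC; apply: Hr; rewrite -ball_normE /ball_ /= distrC.
  by rewrite (_ : x' + q - (x + q) = x' - x) //; lra.
- pose sep x x' := forall eta : R, 0 < eta -> exists w : R, [/\ 0 < w, w < eta &
    shift_total a b q f (x + w) - shift_total a b q f x <>
    shift_total a b q f (x' + w) - shift_total a b q f x'].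
  have H x x' : al < x -> x' < be -> x < x' -> sep x x'.
    move=> alx x'be xx' eta eta0; apply: contrapT => Hn.
    have alx' : al < x' by exact: lt_trans xx'.
    have xbe : x < be by exact: lt_trans x'be.
    have /andP[xa xb] := inab x alx xbe; have /andP[x'a x'b] := inab x' alx' x'be.
    (* The three bounds make an increment below [delta] smaller than [eta], keep both shifted points
       below [b], and ensure that [delta] is less than [x' - x]. *)
    pose delta := Order.min (Order.min eta (b - (x' + q))) ((x' - x) / 2).
    apply: nrep; exists delta, (x + q), (x' + q).
    split; [|exact: inJ|exact: inJ| |].
    + by rewrite !lt_min eta0 subr_gt0 x'b /=; lra.
    + by rewrite gt_min; apply/orP; right; lra.
    + move=> eps; rewrite !lt_min => /andP[e0 /andP[/andP[e1 e2] _]].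
      have i1 : a < x + eps + q < b by apply/andP; split; lra.
      have i2 : a < x' + eps + q < b by apply/andP; split; lra.
      split; [by rewrite /= in_itv /= addrAC|by rewrite /= in_itv /= addrAC|].
      have [<-|en0] := eqVneq 0 eps; first by rewrite !addr0 !subrr.
      apply: contrapT => ne; apply: Hn; exists eps; split=> //.
        by rewrite lt_neqAle en0.
      by rewrite (FE _ i1) (FE _ i2) !FE ?inab // (addrAC x) (addrAC x').
  move=> x x' alx xbe alx' x'be nxx'; case: (ltgtP x x') => // [lt|gt] eta eta0.
    exact: H.
  have [w [h1 h2 h3]] := H x' x alx' xbe gt eta eta0.
  by exists w; split=> //; apply: nesym.
Qed.
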